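(* Let $n,t,k$ be integers with $1\le t\le n$ and $k\ge1$, and let $\Delta_{n,t}^{[k]}$ be the Alexander dual of the Stanley--Reisner complex of the $k$-th squarefree power $I_{n,t}^{[k]}$ of the $t$-path ideal of the path graph $P_n$. Then $$\Delta_{n,t}^{[k]}=\begin{cases}\emptyset, & \text{if } n\le kt,\\ \Delta_t^\lambda, & \text{if } n>kt,\end{cases}$$ where $\lambda=(\lambda_1,\dots,\lambda_{k+1})$ is the partition with $\lambda_i=n-kt$ for all $1\le i\le k+1$, and $\Delta_t^\lambda$ is the associated $t$-Young complex.
   Context: Let $K$ be a field, $R=K[x_1,\dots,x_n]$. $P_n$ is the path graph on $[n]=\{1,\dots,n\}$ with edges $\{i,i+1\}$. The $t$-path ideal $I_{n,t}$ is generated by $x_ix_{i+1}\cdots x_{i+t-1}$ for $1\le i\le n-t+1$. The $k$-th squarefree power $I^{[k]}$ of a squarefree monomial ideal $I$ is generated by the squarefree monomials in the minimal monomial generating set of $I^k$; for $I=I_{n,t}$ it is generated by products of $k$ generators with pairwise disjoint supports (and is $0$ if there are none). The Stanley--Reisner complex of $I_{n,t}^{[k]}$, denoted $\Sigma_{n,t}^{[k]}$, is the complex on $[n]$ of those $F\subseteq[n]$ with $\prod_{i\in F}x_i\notin I_{n,t}^{[k]}$. The Alexander dual of a complex $\Delta$ on $[n]$ is $\Delta^\vee=\{[n]\setminus F: F\subseteq [n],\ F\notin\Delta\}$, and $\Delta_{n,t}^{[k]}=(\Sigma_{n,t}^{[k]})^\vee$. The symbol $\emptyset$ denotes the complex with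 no vertices (no non-empty faces); no distinction is made between the void complex $\{\}$ and $\{\emptyset\}$. A partition $\lambda=(\lambda_1\ge\dots\ge\lambda_r\ge1)$ is identified with its Young diagram (top- and left-justified, $\lambda_j$ boxes in row $j$, row $1$ on top). For a positive integer $t$, fill the box in row $j$, column $i$ with $(r-j)t+i$. The $t$-Young complex $\Delta_t^\lambda$ is the simplicial complex whose facets are all sets $\{a_1<\dots<a_{\lambda_1}\}$ such that $a_j$ is an entry of the $j$-th column of $\lambda$ for every $1\le j\le\lambda_1$. *)

(* Defs.v *)
From HB Require Import structures.
From mathcomp Require Import all_boot all_order all_algebra.
From mathcomp Require Import finmap.
From mathcomp Require Import mpoly.

Set Implicit Arguments.
Unset Strict Implicit.
Unset Printing Implicit Defensive.

Import GRing.Theory.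
Local Open Scope fset_scope.
Local Open Scope ring_scope.

Section Ideals.
Variable A : comNzRingType.

Definition ideal_gen (S : A -> Prop) (f : A) : Prop :=
  exists (m : nat) (c g : 'I_m -> A),
    (forall i, S (g i)) /\ f = \sum_(i < m) c i * g i.

Definition ideal_exp (I : A -> Prop) (k : nat) : A -> Prop :=
  ideal_gen (fun g => exists h : 'I_k -> A,
    (forall i, I (h i)) /\ g = \prod_(i < k) h i).

End Ideals.

Section MonomialIdeals.
Variables (K : fieldType) (n : nat).
Local Notation R := {mpoly K[n]}.

Definition monomial_ideal (G : 'X_{1..n} -> Prop) : R -> Prop :=
  ideal_gen (fun g => exists m, G m /\ g = 'X_[m]).

Definition monomial_generating_set (I : R -> Prop) (G : 'X_{1..n} -> Prop) :=
  forall f, I f <-> monomial_ideal G f.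

Definition minimal_monomial_generating_set
    (I : R -> Prop) (G : 'X_{1..n} -> Prop) :=
  monomial_generating_set I G /\
  forall G' : 'X_{1..n} -> Prop, (forall m, G' m -> G m) ->
    monomial_generating_set I G' -> forall m, G m -> G' m.

(* A monomial ideal has exactly one minimal monomial generating set, so the   *)
(* existential below only serves to refer to it.                              *)
Definition minimal_monomial_generator (I : R -> Prop) (m : 'X_{1..n}) :=
  exists G, minimal_monomial_generating_set I G /\ G m.

Definition squarefree_monomial (m : 'X_{1..n}) := forall i, (m i <= 1)%N.

Definition squarefree_power (I : R -> Prop) (k : nat) : R -> Prop :=
  monomial_ideal (fun m =>
    minimal_monomial_generator (ideal_exp I k) m /\ squarefree_monomial m).

(* The variable x_v of the mathematics, 1 <= v <= n, is 'X_j with v = j.+1.   *)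
Definition var_prod (P : pred nat) : R := \prod_(j < n | P j.+1) 'X_j.

Definition path_ideal (t : nat) : R -> Prop :=
  ideal_gen (fun g => exists i : nat,
    (1 <= i)%N /\ (i + t <= n + 1)%N /\
    g = var_prod (fun v => i <= v <= i + t - 1)%N).

End MonomialIdeals.

(* Complexes are given by their sets of faces. Vertices are positive integers *)
(* and [n] is {1, ..., n}.                                                    *)
Definition complex := {fset nat} -> Prop.

Definition eq_complex (D E : complex) := forall F, D F <-> E F.

(* Covers both the void complex and the complex {fset0}.                      *)
Definition empty_complex (D : complex) := forall F, D F -> F = fset0.

Definition facet (D : complex) (F : {fset nat}) :=
  D F /\ forall G, D G -> F `<=` G -> G = F.

Definition interval_fset (n : nat) : {fset nat} := [fset v in iota 1 n].

Definition alexander_dual (n : nat) (D : complex) : complex := fun G =>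
  exists F, F `<=` interval_fset n /\ ~ D F /\ G = interval_fset n `\` F.

Definition stanley_reisner (K : fieldType) (n : nat)
    (I : {mpoly K[n]} -> Prop) : complex := fun F =>
  F `<=` interval_fset n /\ ~ I (var_prod K n (fun v => v \in F)).

(* path_power_complex is Sigma_{n,t}^{[k]}, path_power_dual Delta_{n,t}^{[k]} *)
Definition path_power_complex (K : fieldType) (n t k : nat) : complex :=
  stanley_reisner (squarefree_power (@path_ideal K n t) k).

Definition path_power_dual (K : fieldType) (n t k : nat) : complex :=
  alexander_dual n (path_power_complex K n t k).

Definition is_partition (lam : seq nat) :=
  sorted geq lam && all (leq 1) lam.

(* Rows and columns are numbered from 1; row 1 is the top row and the longest. *)
Definition part (lam : seq nat) (j : nat) : nat := nth 0%N lam j.-1.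

Definition box_entry (t : nat) (lam : seq nat) (j i : nat) : nat :=
  ((size lam - j) * t + i)%N.

Definition column_entry (t : nat) (lam : seq nat) (i v : nat) :=
  exists j, (1 <= j <= size lam)%N /\ (1 <= i <= part lam j)%N /\
    v = box_entry t lam j i.

Definition young_facet (t : nat) (lam : seq nat) (F : {fset nat}) :=
  exists a : seq nat,
    size a = part lam 1 /\ sorted ltn a /\
    (forall j, (1 <= j <= part lam 1)%N ->
       column_entry t lam j (nth 0%N a j.-1)) /\
    F = [fset v in a].

Definition young_complex (t : nat) (lam : seq nat) : complex := fun F =>
  exists2 A, young_facet t lam A & F `<=` A.

Lemma young_complex_facets (t : nat) (lam : seq nat) (F : {fset nat}) :
  facet (young_complex t lam) F <-> young_facet t lam F.
Proof.
have card_facet A : young_facet t lam A -> #|` A| = part lam 1.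
  case=> a [<- [sa [_ ->]]].
  by rewrite card_fseq undup_id // (sorted_uniq ltn_trans ltnn sa).
split=> [[[A fA sFA] maxF]|fF].
  by have <- : A = F by apply: maxF => //; exists A.
split=> [|G [A fA sGA] sFG]; first by exists F.
have eFA: F = A.
  by apply/eqP; rewrite eqEfcard (fsubset_trans sFG sGA) (card_facet _ fF) (card_facet _ fA) leqnn.
by apply/eqP; rewrite eqEfsubset sFG eFA sGA.
Qed.

(* Main.v *)
(* A squarefree monomial x_F lies in I^{[k]} iff F contains k pairwise disjoint
   intervals of length t: the products of k generators of I all have degree kt,
   so none of them is redundant in I^k.  Hence the faces of the dual are the
   subsets of complements of k disjoint t-intervals in [n].  An element of such a
   complement which comes j-th and lies above c of the intervals equals ct + j,
   which is the entry of column j in row k + 1 - c.  Conversely, for a facet with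
   entries c_j t + j the sequence c_j is nondecreasing, and the complement
   consists of the intervals of length t starting at it + e_i + 1, 0 <= i < k,
   where e_i is the number of j with c_j <= i. *)
Require Import Defs.
From mathcomp Require Import all_boot all_order all_algebra.
From mathcomp Require Import finmap mpoly zify.
From Stdlib Require Import Classical.

Set Implicit Arguments.
Unset Strict Implicit.
Unset Printing Implicit Defensive.

Import GRing.Theory.

(** * Ideals given by generators, and their powers *)

Section IdealGen.
Local Open Scope ring_scope.
Variable A : comNzRingType.
Implicit Types (S T : A -> Prop) (f g : A).

Lemma ideal_gen_sub S g : S g -> ideal_gen S g.
Proof.
by move=> Sg; exists 1%N, (fun=> 1), (fun=> g); split=> //; rewrite big_ord1 mul1r.
Qed.

Lemma ideal_gen0 S : ideal_gen S 0.
Proof. by exists 0%N, (fun=> 0), (fun=> 0); split; [case | rewrite big_ord0]. Qed.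

Lemma ideal_genD S f g : ideal_gen S f -> ideal_gen S g -> ideal_gen S (f + g).
Proof.
move=> [m [c [u [Su ->]]]] [p [d [v [Sv ->]]]]; exists (m + p)%N.
exists (fun i => match split i with inl j => c j | inr j => d j end).
exists (fun i => match split i with inl j => u j | inr j => v j end).
split=> [i|]; first by case: (split i).
rewrite big_split_ord /=; congr (_ + _); apply: eq_bigr => i _.
  by rewrite (unsplitK (inl i)).
by rewrite (unsplitK (inr i)).
Qed.

Lemma ideal_genMl S f g : ideal_gen S g -> ideal_gen S (f * g).
Proof.
move=> [m [c [u [Su ->]]]]; exists m, (fun i => f * c i), u; split=> //.
by rewrite mulr_sumr; apply: eq_bigr => i _; rewrite mulrA.
Qed.

Lemma ideal_gen_sum S (m : nat) (F : 'I_m -> A) :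
  (forall i, ideal_gen S (F i)) -> ideal_gen S (\sum_(i < m) F i).
Proof.
by move=> SF; apply: big_ind => // [|f g]; [apply: ideal_gen0 | apply: ideal_genD].
Qed.

Lemma ideal_gen_le S T f :
  (forall g, S g -> ideal_gen T g) -> ideal_gen S f -> ideal_gen T f.
Proof.
move=> ST [m [c [u [Su ->]]]]; apply: ideal_gen_sum => i.
exact/ideal_genMl/ST.
Qed.

(** Multilinearity: expand the first factor and, by induction, the product of the others; [unlift]
    splices the two choices of generators into one family. *)
Lemma ideal_gen_prod S k (h : 'I_k -> A) : (forall i, ideal_gen S (h i)) ->
  ideal_gen (fun g => exists u : 'I_k -> A,
    (forall i, S (u i)) /\ g = \prod_(i < k) u i) (\prod_(i < k) h i).
Proof.
elim: k h => [|k IH] h Sh.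
  by apply: ideal_gen_sub; exists h; split=> //; case.
rewrite big_ord_recl; have [m [c [u [Su ->]]]] := Sh ord0.
rewrite mulr_suml; apply: ideal_gen_sum => i; rewrite -mulrA; apply: ideal_genMl.
have [p [d [v [Sv ->]]]] := IH _ (fun j => Sh (lift ord0 j)).
rewrite mulr_sumr; apply: ideal_gen_sum => j; rewrite mulrCA; apply: ideal_genMl.
have [w [Sw ->]] := Sv j; apply: ideal_gen_sub.
exists (fun l => if unlift ord0 l is Some l' then w l' else u i); split=> [l|].
  by case: (unlift ord0 l).
by rewrite big_ord_recl unlift_none; congr (_ * _); apply: eq_bigr => l _; rewrite liftK.
Qed.

Lemma ideal_exp_gen S k f :
  ideal_exp (ideal_gen S) k f <->
  ideal_gen (fun g => exists u : 'I_k -> A,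
    (forall i, S (u i)) /\ g = \prod_(i < k) u i) f.
Proof.
split; apply: ideal_gen_le => g [h [Sh ->]]; first exact: ideal_gen_prod.
by apply: ideal_gen_sub; exists h; split=> // i; apply: ideal_gen_sub.
Qed.

End IdealGen.

(** * Monomial ideals and their minimal generators *)

Section MonomialIdeal.
Local Open Scope ring_scope.
Variables (K : fieldType) (n : nat).
Implicit Types (G : 'X_{1..n} -> Prop) (m : 'X_{1..n}).

(** A monomial in the support of a sum is in the support of a summand, and every monomial of [c *
    'X_[g]] is a multiple of [g]. *)
Lemma monomial_ideal_X G m :
  monomial_ideal (K := K) G 'X_[m] <-> exists2 g, G g & (g <= m)%MM.
Proof.
split=> [[p [c [u [Gu eqm]]]]|[g Gg legm]]; last first.
  by rewrite -(submK legm) mpolyXD; apply/ideal_genMl/ideal_gen_sub; exists g.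
have: m \in msupp ('X_[m] : {mpoly K[n]}) by rewrite msuppX mem_head.
rewrite eqm => /msupp_sum_le /flattenP[/= _ /mapP[i _ ->]].
have [g [Gg ->]] := Gu i; rewrite (perm_mem (msuppMX _ _)) => /mapP[m' _ ->].
by exists g; rewrite ?lem_addr.
Qed.

Lemma equigenerated_minimal G (d : nat) (I : {mpoly K[n]} -> Prop) :
  monomial_generating_set I G -> (forall m, G m -> mdeg m = d) ->
  minimal_monomial_generating_set I G.
Proof.
move=> genG degG; split=> // G' subG genG' m Gm.
have /genG/genG'/monomial_ideal_X[g G'g /submK eqm] : monomial_ideal (K := K) G 'X_[m].
  by apply/monomial_ideal_X; exists m; rewrite ?lepm_refl.
have := degG _ Gm; rewrite -eqm mdegD (degG g (subG _ G'g)) => /eqP.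
by rewrite -[X in _ == X]add0n eqn_add2r mdeg_eq0 => /eqP->; rewrite add0m.
Qed.

Definition indicator_mnm (P : pred nat) : 'X_{1..n} :=
  [multinom (P j.+1 : nat) | j < n].

Lemma var_prodE P : var_prod K n P = 'X_[indicator_mnm P].
Proof.
rewrite mpolyXE_id /var_prod big_mkcond; apply: eq_bigr => j _.
by rewrite mnmE; case: (P _); rewrite ?expr1 ?expr0.
Qed.

End MonomialIdeal.

(** * Families of intervals of length [t] *)

Lemma sum_interval s t v : 0 < s ->
  \sum_(1 <= w < v.+1) (s <= w < s + t : nat) = minn v.+1 (s + t) - s.
Proof.
move=> s_gt0; elim: v => [|v IH]; first by rewrite big_geq //; lia.
by rewrite big_nat_recr //= IH; lia.
Qed.

(* Number of the intervals [s i, s i + t) that contain v; such intervals are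
   pairwise disjoint iff this is at most 1 everywhere. *)
Definition interval_mult t k (s : 'I_k -> nat) v :=
  \sum_(i < k) (s i <= v < s i + t : nat).

Definition path_starts n t k (s : 'I_k -> nat) :=
  forall i, (1 <= s i) && (s i + t <= n.+1).

(** A single bound encodes both that the intervals are disjoint and that they lie in [F]. *)
Definition path_packing n t k (s : 'I_k -> nat) (F : {fset nat}) :=
  path_starts n t s /\ forall v, interval_mult t s v <= (v \in F).

(** Double counting: each interval lies inside [n] and contributes [t]. *)
Lemma sum_interval_mult n t k (s : 'I_k -> nat) :
  path_starts n t s -> \sum_(1 <= w < n.+1) interval_mult t s w = k * t.
Proof.
move=> sP; rewrite exchange_big /= -[k in RHS]card_ord -sum_nat_const.
by apply: eq_bigr => i _; have := sP i => /andP[s1 s2]; rewrite sum_interval //; lia.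
Qed.

(** * Generators of the powers of the path ideal *)

Section PathPower.
Variables (K : fieldType) (n t k : nat).
Hypothesis t_gt0 : 0 < t.

(** Intervals may overlap here: these exponents belong to the ordinary power. *)
Definition path_power_mnm (m : 'X_{1..n}) :=
  exists2 s : 'I_k -> nat, path_starts n t s & m = [multinom interval_mult t s j.+1 | j < n].

Lemma path_power_mnm_deg m : path_power_mnm m -> mdeg m = k * t.
Proof.
case=> s sP ->; rewrite -(sum_interval_mult sP) mdegE big_add1 big_mkord.
by apply: eq_bigr => i _; rewrite mnmE.
Qed.

Lemma prod_var_interval (s : 'I_k -> nat) :
  (\prod_(i < k) var_prod K n (fun v => s i <= v <= s i + t - 1)%N =
   'X_[[multinom interval_mult t s j.+1 | j < n]])%R.
Proof.
under eq_bigr do rewrite var_prodE.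
rewrite -(big_morph _ (@mpolyXD _ _) (@mpolyX0 _ _)); congr ('X_[_])%R; apply/mnmP => j; rewrite mnm_sumE mnmE.
apply: eq_bigr => i _; rewrite mnmE; congr nat_of_bool; lia.
Qed.

Lemma path_power_generators :
  monomial_generating_set (ideal_exp (@path_ideal K n t) k) path_power_mnm.
Proof.
move=> f; rewrite /path_ideal ideal_exp_gen; split; apply: ideal_gen_le => g.
- move=> [u [/fin_all_exists[s sP] ->]]; apply: ideal_gen_sub.
  exists [multinom interval_mult t s j.+1 | j < n]; split.
    by exists s => // i; have [s1 [s2 _]] := sP i; rewrite s1 -addn1.
  by rewrite -prod_var_interval; apply: eq_bigr => i _; case: (sP i) => _ [].
- move=> [m [[s sP ->] ->]]; apply: ideal_gen_sub.
  exists (fun i => var_prod K n (fun v => s i <= v <= s i + t - 1)).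
  split=> [i|]; last by rewrite prod_var_interval.
  by have /andP[s1 s2] := sP i; exists (s i); rewrite addn1.
Qed.

Lemma squarefree_power_var_prod F :
  squarefree_power (@path_ideal K n t) k (var_prod K n (fun v => v \in F)) <->
  exists s : 'I_k -> nat, path_packing n t s F.
Proof.
rewrite var_prodE /squarefree_power monomial_ideal_X; split.
- move=> [m [[G [[genG _] Gm]] _] lemF].
  (* [m] lies in the power, so some product of [k] generators divides it, and hence divides the
     monomial of [F]. *)
  have /genG/path_power_generators/monomial_ideal_X[_ [s sP ->] lem] :
      monomial_ideal (K := K) G 'X_[m].
    by apply/monomial_ideal_X; exists m; rewrite ?lepm_refl.
  exists s; split=> // v; case: (boolP (0 < v <= n)) => [/andP[v0 vn]|vn].
    have vn' : v.-1 < n by lia.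
    have /mnm_lepP/(_ (Ordinal vn')) := lepm_trans lem lemF.
    by rewrite !mnmE /= prednK.
  rewrite /interval_mult big1 // => i _; have := sP i; lia.
- move=> [s [sP leF]]; exists [multinom interval_mult t s j.+1 | j < n]; last first.
    by apply/mnm_lepP => j; rewrite !mnmE.
  split; last by move=> j; rewrite mnmE; apply: leq_trans (leF _) (leq_b1 _).
  exists path_power_mnm; split; last by exists s.
  exact: equigenerated_minimal path_power_generators path_power_mnm_deg.
Qed.

End PathPower.

(** * Faces of the Alexander dual *)

Local Open Scope fset_scope.
Local Open Scope nat_scope.

Lemma mem_interval_fset n v : (v \in interval_fset n) = (0 < v <= n).
Proof. by rewrite !inE mem_iota; lia. Qed.

Lemma path_power_dualP (K : fieldType) n t k G : 0 < t ->
  path_power_dual K n t k G <->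
  exists2 s : 'I_k -> nat, path_packing n t s (interval_fset n `\` G) &
    G `<=` interval_fset n.
Proof.
move=> t_gt0; split=> [[F [sF [nF ->]]]|[s sP sG]].
  have /squarefree_power_var_prod[//|s sP] : squarefree_power (@path_ideal K n t) k
      (var_prod K n (fun v => v \in F)).
    (* Faces are defined by non-membership in the ideal, so a non-face gives membership only up to
       double negation. *)
    by apply: NNPP => nI; apply: nF.
  by exists s; rewrite ?fsubsetDl // fsetDK.
exists (interval_fset n `\` G); rewrite fsubsetDl fsetDK //; do 2!split=> //.
by case=> _; apply; apply/squarefree_power_var_prod => //; exists s.
Qed.

(** The [k] disjoint intervals cover [k * t] vertices and miss any vertex of a face, which would
    force [k * t < n]. *)
Lemma path_power_dual_empty (K : fieldType) n t k : 0 < t -> n <= k * t ->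
  empty_complex (path_power_dual K n t k).
Proof.
move=> t_gt0 len G /path_power_dualP[//|s [sP leF] sG].
suff noG (v : nat) : v \notin G.
  by apply/fsetP => v; rewrite in_fset0; apply/negbTE/noG.
apply/negP => Gv.
have vn := fsubsetP sG _ Gv; rewrite mem_interval_fset in vn.
have : \sum_(1 <= w < n.+1) interval_mult t s w <= \sum_(1 <= w < n.+1) (w != v : nat).
  apply: leq_sum => w _; apply: leq_trans (leF w) _.
  by rewrite inE; case: eqP => [->|_]; rewrite ?Gv ?leq_b1.
rewrite (sum_interval_mult sP).
have := sum1_size (index_iota 1 n.+1); rewrite size_iota.
rewrite (eq_bigr (fun w => (w != v) + (w == v))) => [|w _]; last by case: eqP.
rewrite big_split /= [X in _ + X](bigD1_seq v) ?iota_uniq ?mem_index_iota ?ltnS //=.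
rewrite eqxx; lia.
Qed.

(** * Comparison with the Young complex *)

Section Young.
Variables n t k : nat.
Hypotheses (t_gt0 : 0 < t) (kt_lt : k * t < n).
Let lam := nseq k.+1 (n - k * t).

(** Row [j] corresponds to [c = k + 1 - j]; all rows have equal length, so each column meets all of
    them. *)
Lemma column_entryP i v : 0 < i <= n - k * t ->
  column_entry t lam i v <-> exists2 c, c <= k & v = c * t + i.
Proof.
move=> ile; rewrite /column_entry /box_entry size_nseq; split=> [[j [jk [_ ->]]]|[c ck ->]].
  by exists (k.+1 - j) => //; lia.
exists (k.+1 - c); rewrite subKn ?(leqW ck) //; split; first by lia.
by rewrite /part nth_nseq; case: ifP => //; lia.
Qed.

(** The facet containing [G] is the set of all uncovered vertices, those satisfying [p]. *)
Lemma packing_young (s : 'I_k -> nat) (G : {fset nat}) :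
  path_packing n t s (interval_fset n `\` G) -> G `<=` interval_fset n ->
  young_complex t lam G.
Proof.
move=> [sP leF] sG; set p := fun v => interval_mult t s v == 0.
have mult01 v : interval_mult t s v + p v = 1.
  by have := leF v; rewrite /p; case: (_ \in _); case: (interval_mult t s v) => [|[]].
(* Each of 1, ..., [v] is either uncovered or covered exactly once. *)
have countp v : count p (iota 1 v) + \sum_(1 <= w < v.+1) interval_mult t s w = v.
  rewrite -sum1_count big_mkcond /index_iota subn1 -big_split /=.
  rewrite (eq_bigr (fun=> 1)) ?sum1_size ?size_iota // => w _.
  by have := mult01 w; rewrite addnC; case: (p w).
have size_a : size [seq v <- iota 1 n | p v] = n - k * t.
  by rewrite size_filter -[n in RHS]countp (sum_interval_mult sP) addnK.
have index_a v : p v -> 0 < v <= n ->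
    index v [seq w <- iota 1 n | p w] = (count p (iota 1 v)).-1.
  case: v => // v pv vn.
  have -> : count p (iota 1 v.+1) = (count p (iota 1 v)).+1.
    by rewrite -(addn1 v) iotaD count_cat /= add1n pv addn1.
  have -> : iota 1 n = rcons (iota 1 v) v.+1 ++ iota v.+2 (n - v.+1).
    by rewrite -cats1 -(iotaD 1 v 1) addn1 -(iotaD 1 v.+1) subnKC.
  rewrite filter_cat filter_rcons pv index_cat mem_rcons mem_head -cats1 index_cat.
  rewrite mem_filter mem_iota pv add1n ltnn andbF /= eqxx addn0.
  by rewrite size_filter.
(* An interval avoiding [v] lies entirely below it, contributing [t], or entirely above it,
   contributing 0. *)
have entry v : p v ->
    \sum_(1 <= w < v.+1) interval_mult t s w = (\sum_(i < k) (s i <= v)) * t.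
  rewrite /p sum_nat_eq0 => /forallP pv.
  rewrite exchange_big big_distrl; apply: eq_bigr => i _ /=.
  have /andP[s1 s2] := sP i; have := pv i.
  rewrite sum_interval //=; lia.
exists [fset v in [seq v <- iota 1 n | p v]]; last first.
  apply/fsubsetP => v Gv; have := fsubsetP sG v Gv.
  rewrite mem_interval_fset !inE mem_filter mem_iota => vn.
  by have := leF v; rewrite inE Gv leqn0 /p => ->; rewrite add1n ltnS.
exists [seq v <- iota 1 n | p v]; split; first exact: size_a.
split; first exact/sorted_filter/iota_ltn_sorted/ltn_trans.
split=> // j; rewrite -[part lam 1]/(n - k * t) => jm; apply/column_entryP => //.
set v := nth _ _ _.
have ltj : j.-1 < size [seq v <- iota 1 n | p v].
  by rewrite size_a; lia.
have := mem_nth 0 ltj; rewrite -/v mem_filter mem_iota => /andP[pv vn].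
have := index_a v pv; rewrite index_uniq ?filter_uniq ?iota_uniq // => /(_ _) cv.
(* The number of intervals below [v]; the other [j] vertices up to [v] are uncovered. *)
exists (\sum_(i < k) (s i <= v)).
  by rewrite -[k in _ <= k]card_ord -sum1_card leq_sum // => i _; apply: leq_b1.
have := countp v; rewrite entry //.
have : 0 < count p (iota 1 v).
  by rewrite -has_count; apply/hasP; exists v => //; rewrite mem_iota; lia.
have := cv ltac:(lia); lia.
Qed.

(** A downward closed subset of {1, ..., m} is an initial segment, hence determined by its size. *)
Lemma count_downward_closed (p : pred nat) m :
  (forall i j, 0 < i <= j -> j <= m -> p j -> p i) ->
  forall j, 0 < j <= m -> p j = (j <= count p (iota 1 m)).
Proof.
elim: m => [|m IH] pP j jm; first by lia.
rewrite -[m.+1 in RHS]addn1 iotaD count_cat /= addn0 add1n.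
case pm: (p m.+1) => /=.
  have -> : count p (iota 1 m) = m.
    rewrite -[RHS](size_iota 1); apply/eqP; rewrite -all_count; apply/allP => i.
    by rewrite mem_iota => im; apply: pP pm; lia.
  by rewrite (pP _ m.+1) //; lia.
rewrite addn0; have [->|jm'] := eqVneq j m.+1.
  by rewrite pm; have := count_size p (iota 1 m); rewrite size_iota; lia.
by apply: IH => [a b ab bm|]; [apply: pP|]; lia.
Qed.

Lemma young_packing (G : {fset nat}) : young_complex t lam G ->
  exists2 s : 'I_k -> nat, path_packing n t s (interval_fset n `\` G) & G `<=` interval_fset n.
Proof.
case=> _ [a [sz [srt [ce ->]]]] sGa; rewrite -[part lam 1]/(n - k * t) in sz ce.
set m := n - k * t in sz ce.
pose c j := (nth 0 a j.-1 - j) %/ t.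
have cP j : 0 < j <= m -> c j <= k /\ nth 0 a j.-1 = c j * t + j.
  move=> jm; have /column_entryP-/(_ jm)[d dk eqd] := ce j jm.
  by rewrite /c eqd addnK mulnK.
(* From c_j t + j < c_{j+1} t + j + 1 follows c_j t <= c_{j+1} t. *)
have c_step j : 0 < j < m -> c j <= c j.+1.
  move=> jm; have [_ e1] := cP j ltac:(lia); have [_ e2] := cP j.+1 ltac:(lia).
  have : nth 0 a j.-1 < nth 0 a j.
    by apply: (sorted_ltn_nth ltn_trans) => //; rewrite ?inE ?sz; lia.
  rewrite e1; move: e2 => /= ->; nia.
have c_mono i j : 0 < i <= j -> j <= m -> c i <= c j.
  elim: j => [|j IH] ij jm; first by lia.
  have [->//|ij'] := eqVneq i j.+1.
  by apply: leq_trans (c_step j _); [apply: IH|]; lia.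
pose e i := count (fun j => c j <= i) (iota 1 m).
(* Since [c] is nondecreasing, the columns with [c j <= i] are exactly the first [e i]. *)
have eP i j : 0 < j <= m -> (c j <= i) = (j <= e i).
  apply: (count_downward_closed (p := fun j => c j <= i)) => a' b' ab bm.
  exact/leq_trans/c_mono.
have e_mono i j : i <= j -> e i <= e j.
  by move=> ij; apply: sub_count => b /= bi; apply: leq_trans ij.
have e_le i : e i <= m by rewrite /e -[m in _ <= m](size_iota 1) count_size.
have aP (v : nat) : v \in a -> exists2 j, 0 < j <= m & v = c j * t + j.
  move=> va; have jm : 0 < (index v a).+1 <= m by rewrite -sz ltnS index_mem.
  by exists (index v a).+1 => //; have [_ <-] := cP _ jm; rewrite ?nth_index.
have Ga v : v \in G -> v \in a by move/(fsubsetP sGa); rewrite inE.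
have sG : G `<=` interval_fset n.
  apply/fsubsetP => v /Ga/aP[j jm ->]; rewrite mem_interval_fset.
  have [ck _] := cP _ jm; have : c j * t <= k * t by rewrite leq_mul2r ck orbT.
  lia.
exists (fun i : 'I_k => i * t + e i + 1) => //.
have startP : path_starts n t (fun i : 'I_k => i * t + e i + 1).
  move=> i; have ik : i.+1 * t <= k * t by rewrite leq_mul2r ltn_ord orbT.
  have := e_le i; rewrite mulSn in ik; lia.
have disj i j : i < j -> i * t + e i + t <= j * t + e j.
  move=> ij; have := e_mono i j (ltnW ij).
  have : i.+1 * t <= j * t by rewrite leq_mul2r ij orbT.
  rewrite mulSn; lia.
split=> // v; have [i iv|no] := pickP (fun i : 'I_k => i * t + e i + 1 <= v < i * t + e i + 1 + t).
  rewrite /interval_mult (bigD1 i) //= iv big1 ?addn0 => [|i' ne]; last first.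
    by case: (ltngtP i i') => [/disj|/disj|/val_inj eqi]; [lia|lia|rewrite eqi eqxx in ne].
  rewrite lt0b inE mem_interval_fset; apply/andP; split; last by have := startP i; lia.
  (* If [c j <= i], then [j <= e i] and the entry precedes interval [i]; otherwise [j > e i] and
     [c j > i], so it comes after the interval. *)
  apply/negP => /Ga/aP[j jm eqv]; have := eP i j jm; case: (leqP (c j) i) => ci.
    have : c j * t <= i * t by rewrite leq_mul2r ci orbT.
    lia.
  have : i.+1 * t <= c j * t by rewrite leq_mul2r ci orbT.
  rewrite mulSn; lia.
by rewrite /interval_mult big1 // => i _; rewrite no.
Qed.

End Young.

Theorem proposition3p1 (K : fieldType) (n t k : nat)
    (ht : (1 <= t <= n)%N) (hk : (1 <= k)%N) :
  ((n <= k * t)%N -> empty_complex (path_power_dual K n t k)) /\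
  ((k * t < n)%N ->
     let lam := nseq k.+1 (n - k * t)%N in
     is_partition lam /\
     eq_complex (path_power_dual K n t k) (young_complex t lam)).
Proof.
have t_gt0 : 0 < t by case/andP: ht.
split=> [|kt_lt lam]; first exact: path_power_dual_empty.
split=> [|G].
  apply/andP; split; last by rewrite all_nseq subn_gt0 kt_lt orbT.
  by rewrite /lam; elim: k.+1 => //= -[|m] //= ->; rewrite leqnn.
rewrite path_power_dualP //; split=> [[s sP sG]|]; first exact: packing_young sP sG.
exact: young_packing.
Qed.
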